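(* Let $\alpha,\beta>-1$ be real, and let $r_n^b(x)=v_{n+1}(x)/v_n(x)$, $n>0$, be the ratios of consecutive solutions $v_n(x)$ of the homogeneous adjoint three-term recurrence for the Jacobi polynomials $P_n^{(\alpha,\beta)}$ (defined in the context). Then for every integer $n\ge 1$, $$r_n^b(1)=\frac{n+1}{n}\,\frac{(\alpha+\beta+n+1)(\alpha+\beta+2n)}{(n+\beta)(\alpha+\beta+2n+2)}$$ and $$r_n^b(-1)=-\frac{n+1}{n}\,\frac{(\alpha+\beta+n+1)(\alpha+\beta+2n)}{(n+\alpha)(\alpha+\beta+2n+2)}.$$
   Context: The Jacobi polynomials $P_n^{(\alpha,\beta)}$ satisfy the three-term recurrence $P_{n+1}^{(\alpha,\beta)}(x)=(A_nx+B_n)P_n^{(\alpha,\beta)}(x)-C_nP_{n-1}^{(\alpha,\beta)}(x)$, with $P_{-1}^{(\alpha,\beta)}=0$, $P_0^{(\alpha,\beta)}=1$, where $$A_n=\frac{(2n+\alpha+\beta+1)(2n+\alpha+\beta+2)}{2(n+1)(n+\alpha+\beta+1)},$$ $$B_n=\frac{(\alpha^2-\beta^2)(2n+\alpha+\beta+1)}{2(n+1)(n+\alpha+\beta+1)(2n+\alpha+\beta)},$$ $$C_n=\frac{(n+\alpha)(n+\beta)(2n+\alpha+\beta+2)}{(n+1)(n+\alpha+\beta+1)(2n+\alpha+\beta)}.$$ For $n=0$, common factors are cancelled, so that $A_0=\frac{\alpha+\beta+2}{2}$ and $B_0=\frac{\alpha-\beta}{2}$ (this matters only when $\alpha+\beta\in\{0,-1\}$).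 The homogeneous adjoint three-term recurrence defines a sequence $v_n(x)$, $n\ge0$, by $v_0(x)=0$, $v_1(x)=1$ and $$v_n(x)=(A_nx+B_n)v_{n+1}(x)-C_{n+1}v_{n+2}(x),\qquad n\ge 0$$ (note that $C_{n+1}\neq0$ for $n\ge 0$, so this determines $v_{n+2}$ from $v_n,v_{n+1}$). The ratios are $r_n^b(x):=v_{n+1}(x)/v_n(x)$ for integers $n>0$. *)

(* Defs.v *)
From HB Require Import structures.
From mathcomp Require Import all_boot all_order all_algebra.
From mathcomp Require Import reals.
From mathcomp Require Import lra.

Set Implicit Arguments.
Unset Strict Implicit.
Unset Printing Implicit Defensive.

Import Order.TTheory GRing.Theory Num.Theory.
Local Open Scope ring_scope.

(* Recurrence coefficients of the Jacobi polynomials P_n^(alpha,beta):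
     P_(n+1)(x) = (A_n x + B_n) P_n(x) - C_n P_(n-1)(x).
   At n = 0 the common factors of A and B are cancelled, so that the values
   remain meaningful when alpha + beta is 0 or -1. *)
Definition jacobiA (R : fieldType) (alpha beta : R) (n : nat) : R :=
  if n == 0 then (alpha + beta + 2) / 2
  else ((2 * n%:R + alpha + beta + 1) * (2 * n%:R + alpha + beta + 2))
       / (2 * (n%:R + 1) * (n%:R + alpha + beta + 1)).

Definition jacobiB (R : fieldType) (alpha beta : R) (n : nat) : R :=
  if n == 0 then (alpha - beta) / 2
  else ((alpha ^+ 2 - beta ^+ 2) * (2 * n%:R + alpha + beta + 1))
       / (2 * (n%:R + 1) * (n%:R + alpha + beta + 1)
            * (2 * n%:R + alpha + beta)).

(* Only C_n with 1 <= n is used: C_0 multiplies P_(-1) = 0 in the recurrence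
   and does not occur in its adjoint. *)
Definition jacobiC (R : fieldType) (alpha beta : R) (n : nat) : R :=
  ((n%:R + alpha) * (n%:R + beta) * (2 * n%:R + alpha + beta + 2))
  / ((n%:R + 1) * (n%:R + alpha + beta + 1) * (2 * n%:R + alpha + beta)).

(* The adjoint recurrence v_n = (A_n x + B_n) v_(n+1) - C_(n+1) v_(n+2),
   solved for v_(n+2); see jacobi_adjointE for the original form. *)
Fixpoint jacobi_adjoint (R : fieldType) (alpha beta : R) (n : nat) (x : R)
    {struct n} : R :=
  match n with
  | 0 => 0
  | n1.+1 =>
    match n1 with
    | 0 => 1
    | m.+1 =>
      ((jacobiA alpha beta m * x + jacobiB alpha beta m)
         * jacobi_adjoint alpha beta n1 x
       - jacobi_adjoint alpha beta m x) / jacobiC alpha beta n1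
    end
  end.

(* r_n^b(x), for 0 < n. Since y / 0 = 0, an equation giving it a nonzero value
   also says that v_n(x) != 0. *)
Definition jacobi_adjoint_ratio (R : fieldType) (alpha beta : R) (n : nat)
    (x : R) : R :=
  jacobi_adjoint alpha beta n.+1 x / jacobi_adjoint alpha beta n x.

Lemma jacobiC_neq0 (R : realFieldType) (alpha beta : R) (n : nat) :
  -1 < alpha -> -1 < beta -> jacobiC alpha beta n.+1 != 0.
Proof.
move=> ha hb; have hn : 0 <= n%:R :> R by rewrite ler0n.
rewrite /jacobiC -natr1 mulf_neq0 ?invr_eq0 ?mulf_neq0 //; apply: lt0r_neq0; lra.
Qed.

Lemma jacobi_adjointE (R : realFieldType) (alpha beta : R) (n : nat) (x : R) :
  -1 < alpha -> -1 < beta ->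
  jacobi_adjoint alpha beta n x =
    (jacobiA alpha beta n * x + jacobiB alpha beta n)
      * jacobi_adjoint alpha beta n.+1 x
    - jacobiC alpha beta n.+1 * jacobi_adjoint alpha beta n.+2 x.
Proof.
move=> ha hb.
have -> : jacobi_adjoint alpha beta n.+2 x =
  ((jacobiA alpha beta n * x + jacobiB alpha beta n)
     * jacobi_adjoint alpha beta n.+1 x
   - jacobi_adjoint alpha beta n x) / jacobiC alpha beta n.+1 by [].
by rewrite [_ * (_ / _)]mulrC divfK ?jacobiC_neq0 // subKr.
Qed.

(* Main.v *)
Require Import Defs.
From HB Require Import structures.
From mathcomp Require Import all_boot all_order all_algebra.
From mathcomp Require Import reals.
From mathcomp Require Import ring lra.

Set Implicit Arguments.
Unset Strict Implicit.
Unset Printing Implicit Defensive.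

Import Order.TTheory GRing.Theory Num.Theory.
Local Open Scope ring_scope.

(** Put v_(n+1) = y_n / (C_1 ... C_n).  The adjoint recurrence for v is then the
    Jacobi recurrence for y, with y_(-1) = 0 and y_0 = 1; so y_n = P_n and
    v_(n+1) / v_n = P_n / (P_(n-1) C_n).  At x = 1, where
    P_n(1) = (alpha + 1) ... (alpha + n) / n!, this ratio is
    (n + alpha) / (n C_n), which is the claimed value.

    The proof runs this argument on the reciprocal ratio
    n C_n / (n + alpha), called [adjoint_coratio] after cancelling n + alpha.
    That P_n(1) satisfies the three-term recurrence amounts to the identity
    [jacobiAB_split], and [jacobi_adjoint_coratio] follows by induction.

    The value at x = -1 comes from the parity relation [jacobi_adjointN]:
    replacing x by -x amounts to exchanging alpha and beta, up to sign. *)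

(** The cancellation of n + alpha makes this vanish at n = 0 even when
    alpha = 0, in agreement with v_0 = 0. *)
Definition adjoint_coratio (R : fieldType) (alpha beta : R) (n : nat) : R :=
  (n%:R * (n%:R + beta) * (2 * n%:R + alpha + beta + 2))
  / ((n%:R + 1) * (n%:R + alpha + beta + 1) * (2 * n%:R + alpha + beta)).

Lemma jacobiC_coratio (R : fieldType) (alpha beta : R) (n : nat) :
  n%:R * jacobiC alpha beta n = (n%:R + alpha) * adjoint_coratio alpha beta n.
Proof. by rewrite /jacobiC /adjoint_coratio; ring. Qed.

(** The three-term recurrence at x = 1 divided by P_n(1): the first summand is
    P_(n+1)(1) / P_n(1), the second is C_n P_(n-1)(1) / P_n(1). *)
Lemma jacobiAB_split (R : realFieldType) (alpha beta : R) (n : nat) :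
  -1 < alpha -> -1 < beta ->
  jacobiA alpha beta n + jacobiB alpha beta n =
    (n%:R + 1 + alpha) / (n%:R + 1) + adjoint_coratio alpha beta n.
Proof.
move=> ha hb; rewrite /jacobiA /jacobiB /adjoint_coratio.
case: n => [|n] /=; first by rewrite !mul0r addr0 add0r; field.
have hn : 0 <= n%:R :> R by rewrite ler0n.
by rewrite -natr1; field; do ?[apply/andP; split]; apply: lt0r_neq0; lra.
Qed.

(** The initial value v_0 = 0 starts the induction: at n = 0 both sides vanish.
    The step compares the recurrence at x = 1 with [jacobiAB_split]. *)
Lemma jacobi_adjoint_coratio (R : realFieldType) (alpha beta : R) (n : nat) :
  -1 < alpha -> -1 < beta ->
  jacobi_adjoint alpha beta n 1 =
    adjoint_coratio alpha beta n * jacobi_adjoint alpha beta n.+1 1.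
Proof.
move=> ha hb; elim: n => [|n IHn]; first by rewrite /adjoint_coratio !mul0r.
have hn : 0 <= n%:R :> R by rewrite ler0n.
have n1_neq0 : n%:R + 1 != 0 :> R by apply: lt0r_neq0; lra.
have na_neq0 : n%:R + 1 + alpha != 0 by apply: lt0r_neq0; lra.
(* Subtracting the induction hypothesis from the recurrence leaves
   C_(n+1) v_(n+2) = (n + 1 + alpha) / (n + 1) v_(n+1). *)
have := jacobi_adjointE n 1 ha hb.
rewrite mulr1 jacobiAB_split // {1}IHn mulrDl => rec.
have {}rec : jacobiC alpha beta n.+1 * jacobi_adjoint alpha beta n.+2 1 =
    (n%:R + 1 + alpha) / (n%:R + 1) * jacobi_adjoint alpha beta n.+1 1.
  by move: rec; set u := _ / _ * _; set w := _ * _; set z := _ * _ => rec; lra.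
have Cq := jacobiC_coratio alpha beta n.+1.
rewrite -natr1 in Cq.
apply: (mulfI na_neq0).
rewrite mulrA -Cq -mulrA rec.
by field.
Qed.

Lemma jacobi_adjoint1_neq0 (R : realFieldType) (alpha beta : R) (n : nat) :
  -1 < alpha -> -1 < beta -> jacobi_adjoint alpha beta n.+1 1 != 0.
Proof.
move=> ha hb; elim: n => [|n]; first exact: oner_neq0.
by rewrite jacobi_adjoint_coratio // mulf_eq0 negb_or => /andP[].
Qed.

Lemma jacobi_adjoint_ratio1 (R : realFieldType) (alpha beta : R) (n : nat) :
  -1 < alpha -> -1 < beta ->
  jacobi_adjoint_ratio alpha beta n 1 = (adjoint_coratio alpha beta n)^-1.
Proof.
move=> ha hb; rewrite /jacobi_adjoint_ratio (@jacobi_adjoint_coratio _ _ _ n) //.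
by rewrite invfM mulrCA divff ?mulr1 // jacobi_adjoint1_neq0.
Qed.

(** A_n and C_n are symmetric in alpha and beta while B_n is antisymmetric, so
    that A_n x + B_n changes sign when x does and alpha, beta are exchanged. *)
Lemma jacobi_adjointN (R : fieldType) (alpha beta : R) (n : nat) (x : R) :
  jacobi_adjoint alpha beta n (- x) =
    (-1) ^+ n.+1 * jacobi_adjoint beta alpha n x.
Proof.
have AB m : jacobiA alpha beta m * - x + jacobiB alpha beta m =
    - (jacobiA beta alpha m * x + jacobiB beta alpha m).
  have sumC (u : R) : u + alpha + beta = u + beta + alpha by rewrite addrAC.
  by rewrite /jacobiA /jacobiB !sumC (addrC alpha); case: ifP => _; ring.
have C m : jacobiC alpha beta m = jacobiC beta alpha m.
  by rewrite /jacobiC !(addrAC _ alpha beta) (mulrC (_ + alpha)).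
(* The recurrence has order two, hence the paired induction. *)
suff: jacobi_adjoint alpha beta n (- x) =
        (-1) ^+ n.+1 * jacobi_adjoint beta alpha n x
   /\ jacobi_adjoint alpha beta n.+1 (- x) =
        (-1) ^+ n.+2 * jacobi_adjoint beta alpha n.+1 x by case.
elim: n => [|n [IH0 IH1]]; first by rewrite /= mulr0 sqrrN expr1n mulr1.
split=> //.
have step a b y : jacobi_adjoint a b n.+2 y =
  ((jacobiA a b n * y + jacobiB a b n) * jacobi_adjoint a b n.+1 y
   - jacobi_adjoint a b n y) / jacobiC a b n.+1 by [].
by rewrite !step IH0 IH1 AB C !exprS; ring.
Qed.

Lemma jacobi_adjoint_ratioN (R : fieldType) (alpha beta : R) (n : nat) (x : R) :
  jacobi_adjoint_ratio alpha beta n (- x) =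
    - jacobi_adjoint_ratio beta alpha n x.
Proof.
rewrite /jacobi_adjoint_ratio !jacobi_adjointN (exprS _ n.+1) mulN1r mulNr mulNr.
by rewrite -mulf_div divff ?mul1r // signr_eq0.
Qed.

Theorem lemma4p1 (R : realType) (alpha beta : R)
    (halpha : -1 < alpha) (hbeta : -1 < beta) (n : nat) (hn : (1 <= n)%N) :
  jacobi_adjoint_ratio alpha beta n 1 =
    (n%:R + 1) / n%:R
    * (((alpha + beta + n%:R + 1) * (alpha + beta + 2 * n%:R))
       / ((n%:R + beta) * (alpha + beta + 2 * n%:R + 2)))
  /\
  jacobi_adjoint_ratio alpha beta n (-1) =
    - ((n%:R + 1) / n%:R
       * (((alpha + beta + n%:R + 1) * (alpha + beta + 2 * n%:R))
          / ((n%:R + alpha) * (alpha + beta + 2 * n%:R + 2)))).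
Proof.
have n_ge1 : 1 <= n%:R :> R by rewrite ler1n.
rewrite jacobi_adjoint_ratioN !jacobi_adjoint_ratio1 // /adjoint_coratio.
by split; field; do ?[apply/andP; split]; apply: lt0r_neq0; lra.
Qed.
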